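(* Let $E$ and $F$ be vector spaces over $\mathbb{K}$, where $\mathbb{K}=\mathbb{R}$ or $\mathbb{K}=\mathbb{C}$, and let $m$ be a positive integer. Then every $m$-linear mapping $A:E^m\to F$ is an $m$-homogeneous polynomial on the vector space $E^m$, i.e. $\mathcal{L}_a(^mE;F)\subset\mathcal{P}_a(^m(E^m);F)$.
   Context: $\mathcal{L}_a(^mE;F)$ denotes the vector space of all $m$-linear mappings $E^m\to F$. A map $Q:G\to F$ between vector spaces over $\mathbb{K}$ is an $m$-homogeneous polynomial if there is an $m$-linear mapping $B:G^m\to F$ with $Q(x)=B(x,\ldots,x)$ for every $x\in G$; $\mathcal{P}_a(^{m}G;F)$ is the vector space of all such maps. No continuity is required. $E^m$ carries the componentwise vector space structure. *)

(* Defs.v *)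
From HB Require Import structures.
From mathcomp Require Import all_boot all_order all_algebra.

Set Implicit Arguments.
Unset Strict Implicit.
Unset Printing Implicit Defensive.

Import GRing.Theory.
Local Open Scope ring_scope.

(* [E ^ m] is [{ffun 'I_m -> E}], with its componentwise lmodType structure. *)

Definition subst_coord (E : Type) (m : nat) (x : E ^ m) (i : 'I_m) (u : E)
  : E ^ m := [ffun j => if j == i then u else x j].

Definition multilinear (K : fieldType) (E F : lmodType K) (m : nat)
    (A : E ^ m -> F) : Prop :=
  forall (i : 'I_m) (x : E ^ m), linear (fun u : E => A (subst_coord x i u)).

Definition homogeneous_polynomial (K : fieldType) (G F : lmodType K) (m : nat)
    (Q : G -> F) : Prop :=
  exists2 B : G ^ m -> F, multilinear B & forall x : G, Q x = B [ffun=> x].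

(* Main.v *)
Require Import Defs.
From HB Require Import structures.
From mathcomp Require Import all_boot all_order all_algebra reals complex.

Set Implicit Arguments.
Unset Strict Implicit.
Unset Printing Implicit Defensive.

Import GRing.Theory.
Local Open Scope ring_scope.

Theorem corollary2p4 (R : realType) (K : fieldType)
    (hK : K = R :> fieldType \/ K = R[i] :> fieldType)
    (E F : lmodType K) (m : nat) (hm : (0 < m)%N)
    (A : E ^ m -> F) (hA : multilinear A) :
  homogeneous_polynomial m A.
Proof.
(* The witness takes from the [i]-th argument only its [i]-th coordinate: B(y_1, ..., y_m) = A(y_11,
   ..., y_mm). If all arguments equal [x], this diagonal is [x] itself. *)
exists (fun y : ((E ^ m) ^ m)%type => A [ffun i => y i i]) =>
  [i y a u v /=|x]; last first.
  by congr A; apply/ffunP => i; rewrite !ffunE.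
(* Changing the [i]-th argument to [w] alters only the [i]-th diagonal entry, so linearity of the
   witness in slot [i] becomes that of [A], because [w i] is linear in [w]. *)
have diagE w : [ffun j => subst_coord y i w j j]
    = subst_coord [ffun j => y j j] i (w i) :> (E ^ m)%type.
  by apply/ffunP => j; rewrite !ffunE; case: eqP => [->|].
by rewrite !diagE !ffunE; apply: hA.
Qed.
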